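(* Let $k\ge0$ be an integer and let $\theta_1,\dots,\theta_k\in E^*$ be linearly independent with $\operatorname{im} d\cap\mathrm{Vect}(\theta_1,\dots,\theta_k)=\{0\}$; set $\vartheta=\theta_1\wedge\dots\wedge\theta_k$. Let $\omega_\vartheta:\mathbb K^k\to E^*$, $(t_1,\dots,t_k)\mapsto t_1\theta_1+\dots+t_k\theta_k$, let $d\oplus\omega_\vartheta:(\ker d)^\perp\oplus\mathbb K^k\to E^*$ be the map $(f,t)\mapsto df+\omega_\vartheta(t)$, the direct sum being orthogonal and $\mathbb K^k$ having its usual inner product, and let $\Delta_\vartheta=(d\oplus\omega_\vartheta)^*(d\oplus\omega_\vartheta)$. Then $$L_k(\vartheta,\underline x)=B(\underline x)\,\big\|(\Pi^{\ker d^*})^{\wedge k}(\vartheta)\big\|^2=\det\Delta_\vartheta,$$ where $L_k(\vartheta,\underline x)=\sum_{K\in\mathcal B_k(\mathcal M)}w(K)\,\underline x^K$ and $B(\underline x)=\sum_{T\in\mathcal B(\mathcal M)}w(T)\,\underline x^T$.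
   Context: Let $\mathbb K=\mathbb R$ or $\mathbb C$, $S=\{1,\dots,s\}$, $E$ an $s$-dimensional $\mathbb K$-vector space with basis $(e_i)_{i\in S}$, $F$ a finite-dimensional $\mathbb K$-vector space, and $\partial:E\to F$ a linear map. Let $\mathcal M$ be the linear matroid on $S$ whose independent sets are the $I\subseteq S$ such that $\{\partial(e_i):i\in I\}$ is linearly independent; $\mathcal B(\mathcal M)$ is its set of bases, $n=\operatorname{rank}\partial$ its rank, $Z=\ker\partial$. $\mathcal B_k(\mathcal M)$ is the set of subsets of $S$ of cardinality $n+k$ which contain a basis of $\mathcal M$. For $J\subseteq S$, $E_J=\mathrm{Vect}(e_j:j\in J)$, and $Z_K=Z\cap E_K$. For $T\in\mathcal B(\mathcal M)$ one has $E=E_T\oplus Z$, and $\mathsf Z_T:E\to Z$ is the corresponding projection. For $K\in\mathcal B_k(\mathcal M)$ containing $T$, $\mathscr Z^K_T=(\mathsf Z_T(e_j):j\in K\setminus T)$, ordered by the order of $S$, is a basis of $Z_K$. If $\mathscr Z^K_T=(z_1,\dots,z_k)$ then $(\vartheta,\det\mathscr Z^K_T)=\det(\theta_i(z_j))_{1\le i,j\le k}$. The dual spaces $E^*$ and $F^*$ are inner product spaces (antilinear in the first variable), and the dual basis $(e_i^\star)_{i\in S}$ of $E^*$ is orthogonal, with $\langle e_i^\star,e_j^\star\rangle=x_i\delta_{ij}$ for positive weights $\underline x=(x_i)_{i\in S}$; $\underline x^I=\prod_{i\in I}x_i$. $d:F^*\to E^*$ is the transpose of $\partial$, $d^*$ is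 the adjoint of $d$, $\Pi^{\ker d^*}$ the orthogonal projection on $\ker d^*$; the norm on $\bigwedge^kE^*$ comes from $\langle u_1\wedge\dots\wedge u_k,v_1\wedge\dots\wedge v_k\rangle=\det(\langle u_i,v_j\rangle)$. Set $E^*_T=\mathrm{Vect}(e_i^\star:i\in T)$. For $T\in\mathcal B(\mathcal M)$, $w(T)$ is the real number, independent of $\underline x$, such that $\det\big((dd^* )^{E^*_T}_{E^*_T}\big)=w(T)\,\underline x^T$, where $(dd^* )^{E^*_T}_{E^*_T}$ is the compression of $dd^*$ to $E^*_T$ (restriction to $E^*_T$ followed by orthogonal projection onto $E^*_T$). For $K\in\mathcal B_k(\mathcal M)$, $w(K)=w(T)\,|(\vartheta,\det\mathscr Z^K_T)|^2$ for any basis $T\subseteq K$ of $\mathcal M$ (this does not depend on the choice of $T$). *)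

(* Defs.v *)
From HB Require Import structures.
From mathcomp Require Import all_boot all_order all_fingroup all_algebra.
From mathcomp Require Import sesquilinear complex.
From mathcomp Require Import boolp classical_sets reals.

Set Implicit Arguments.
Unset Strict Implicit.
Unset Printing Implicit Defensive.

Import Order.TTheory GRing.Theory Num.Theory.

Local Open Scope ring_scope.

Inductive real_or_complex (R : realType) :
    forall K : numFieldType, {rmorphism K -> K} -> Prop :=
| RealField : real_or_complex R (idfun : {rmorphism R -> R})
| ComplexField : real_or_complex R (@conjc R : {rmorphism R[i] -> R[i]}).

Definition lfun_det (K : fieldType) (V : vectType K) (f : 'End(V)) : K :=
  \det (passmx.mxof (vbasis {:V}) (vbasis {:V}) f).

Section InnerProduct.
Variable K : numFieldType.

(* The forms of [sesquilinear] are linear in their first argument and antilinear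
   in the second one; the inner products <u, v> considered here are antilinear
   in u. *)
Definition inner (V : vectType K) (ip : V -> V -> K) (u v : V) : K := ip v u.

Definition is_adjoint (U V : vectType K) (ipU : U -> U -> K) (ipV : V -> V -> K)
    (f : 'Hom(U, V)) (g : 'Hom(V, U)) : Prop :=
  forall v u, inner ipU (g v) u = inner ipV v (f u).

Definition adjoint (U V : vectType K) (ipU : U -> U -> K) (ipV : V -> V -> K)
    (f : 'Hom(U, V)) : 'Hom(V, U) :=
  xget 0 (is_adjoint ipU ipV f).

Variable conj : {rmorphism K -> K}.

Definition orthproj (V : vectType K) (ip : {dot V for conj}) (W : {vspace V}) :
    'End(V) :=
  daddv_pi W (orthov ip W).

Definition compression (V : vectType K) (ip : {dot V for conj})
    (W : {vspace V}) (f : 'End(V)) : 'End(subvs_of W) :=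
  linfun (vsproj W \o orthproj ip W \o f \o vsval).

(* The inner product of the orthogonal direct sum W (+) K^k. *)
Definition dsum_ip (V : vectType K) (ip : {dot V for conj}) (W : {vspace V})
    (k : nat) (p q : (subvs_of W * 'rV[K]_k)%type) : K :=
  ip (vsval p.1) (vsval q.1) + \sum_i p.2 0 i * conj (q.2 0 i).

End InnerProduct.

Section ExteriorPower.
Variables (K : numFieldType) (conj : {rmorphism K -> K}) (V : vectType K).
Variable k : nat.

Definition ksubset (m : nat) := {I : {set 'I_m} | #|I| == k}.

(* The increasing enumeration of I. *)
Definition ksubset_nth m (I : ksubset m) (j : 'I_k) : 'I_m :=
  enum_val (cast_ord (esym (eqP (valP I))) j).

Local Notation b := (vbasis {:V}).

(* The k-th exterior power of V, in coordinates: a stands for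
   \sum_I a_I b_(i_1) /\ ... /\ b_(i_k), the sum being over the subsets
   I = {i_1 < ... < i_k} of indices of a basis b of V. *)
Definition ext_power := {ffun ksubset (\dim {:V}) -> K}.

Definition wedge (u : 'I_k -> V) : ext_power :=
  [ffun I => \det (\matrix_(i < k, j < k) coord b (ksubset_nth I j) (u i))].

Definition ext_map (f : 'End(V)) (a : ext_power) : ext_power :=
  [ffun J => \sum_I a I * wedge (fun i => f b`_(ksubset_nth I i)) J].

Definition ext_ip (ip : {dot V for conj}) (a c : ext_power) : K :=
  \sum_I \sum_J a I * conj (c J) *
    \det (\matrix_(i < k, j < k) ip b`_(ksubset_nth I i) b`_(ksubset_nth J j)).

End ExteriorPower.

Section Matroid.
Variables (K : numFieldType) (s : nat) (E F : vectType K).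
Variables (e : s.-tuple E) (bd : 'Hom(E, F)).

Definition indep (I : {set 'I_s}) : bool := free [seq bd (tnth e i) | i <- enum I].

Definition bases : {set {set 'I_s}} := [set T | maxset indep T].

Definition nbases (k : nat) : {set {set 'I_s}} :=
  [set J : {set 'I_s} | (#|J| == \dim (limg bd) + k)%N &
                        [exists T in bases, T \subset J]].

Definition span_on (J : {set 'I_s}) : {vspace E} := <<[seq tnth e j | j <- enum J]>>.

(* The projection onto ker bd along E_T. *)
Definition proj_ker (T : {set 'I_s}) : 'End(E) := daddv_pi (lker bd) (span_on T).

Definition ker_basis (T J : {set 'I_s}) : seq E :=
  [seq proj_ker T (tnth e j) | j <- enum (J :\: T)].

Definition det_pairing (k : nat) (theta : k.-tuple 'Hom(E, K^o)) (z : seq E) : K :=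
  \det (\matrix_(i < k, j < k) (tnth theta i z`_j : K)).

Definition transpose : 'Hom('Hom(F, K^o), 'Hom(E, K^o)) :=
  linfun (fun f : 'Hom(F, K^o) => (f \o bd)%VF).

Definition dual_vec (i : 'I_s) : 'Hom(E, K^o) := linfun (coord e i : E -> K^o).

Definition dual_span (T : {set 'I_s}) : {vspace 'Hom(E, K^o)} :=
  <<[seq dual_vec i | i <- enum T]>>.

Variable conj : {rmorphism K -> K}.

Definition orthogonal_dual_basis (x : 'I_s -> K)
    (ipE : {dot 'Hom(E, K^o) for conj}) : Prop :=
  forall i j, inner ipE (dual_vec i) (dual_vec j) = if i == j then x i else 0.

Variable ipF : {dot 'Hom(F, K^o) for conj}.

Definition is_basis_weight (T : {set 'I_s}) (w : K) : Prop :=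
  w \is Num.real /\
  forall (x : 'I_s -> K) (ipE : {dot 'Hom(E, K^o) for conj}),
    (forall i, 0 < x i) -> orthogonal_dual_basis x ipE ->
    lfun_det (compression ipE (dual_span T)
                (transpose \o adjoint ipF ipE transpose)%VF)
    = w * \prod_(i in T) x i.

Definition basis_weight (T : {set 'I_s}) : K := xget 0 (is_basis_weight T).

Variables (k : nat) (theta : k.-tuple 'Hom(E, K^o)).

Definition is_weight (J : {set 'I_s}) (w : K) : Prop :=
  forall T, T \in bases -> T \subset J ->
    w = basis_weight T * `|det_pairing theta (ker_basis T J)| ^+ 2.

Definition weight (J : {set 'I_s}) : K := xget 0 (is_weight J).

Definition basis_poly (x : 'I_s -> K) : K :=
  \sum_(T in bases) basis_weight T * \prod_(i in T) x i.

Definition nbases_poly (x : 'I_s -> K) : K :=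
  \sum_(J in nbases k) weight J * \prod_(i in J) x i.

Definition dsum_map :
    'Hom((subvs_of (orthov ipF (lker transpose)) * 'rV[K]_k)%type,
         'Hom(E, K^o)) :=
  linfun (fun p : (subvs_of (orthov ipF (lker transpose)) * 'rV[K]_k)%type =>
    transpose (vsval p.1) + \sum_(i < k) p.2 0 i *: tnth theta i).

Definition laplacian (ipE : {dot 'Hom(E, K^o) for conj}) :
    'End((subvs_of (orthov ipF (lker transpose)) * 'rV[K]_k)%type) :=
  (adjoint (@dsum_ip _ _ _ ipF _ k) ipE dsum_map \o dsum_map)%VF.

End Matroid.

Definition is_inner_product (K : numFieldType) (conj : {rmorphism K -> K})
    (V : vectType K) (ip : V -> V -> K) : Prop :=
  [/\ forall a u v w, ip (a *: u + v) w = a * ip u w + ip v w,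
      forall u v, ip u v = conj (ip v u)
    & forall u, u != 0 -> 0 < ip u u].

Lemma dot_inner_product (K : numFieldType) (conj : {rmorphism K -> K})
    (V : vectType K) (ip : {dot V for conj}) : is_inner_product conj ip.
Proof.
split=> [a u v w|u v|u]; last exact: neq0_dnorm_gt0.
  exact: linearPl.
by rewrite hermC expr0 mul1r.
Qed.

Lemma real_or_complex_norm (R : realType) (K : numFieldType)
    (conj : {rmorphism K -> K}) :
  real_or_complex R conj -> involutive conj /\ forall z, z * conj z = `|z| ^+ 2.
Proof.
case=> [|{conj}]; split=> //.
- by move=> z /=; rewrite real_normK ?num_real.
- exact: conjcK.
- by move=> z; rewrite sqr_normc.
Qed.

Section AdjointTheory.
Variables (K : numFieldType) (conj : {rmorphism K -> K}).

Section OneForm.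
Variables (V : vectType K) (ip : V -> V -> K).
Hypothesis ipP : is_inner_product conj ip.

Lemma ip_suml n (a : 'I_n -> K) (u : 'I_n -> V) w :
  ip (\sum_i a i *: u i) w = \sum_i a i * ip (u i) w.
Proof.
case: ipP => ipL _ _; have ip0 : ip 0 w = 0.
  by have /eqP := ipL 1 0 0 w; rewrite scaler0 addr0 mul1r -subr_eq0 opprD addNKr oppr_eq0 => /eqP.
elim/big_rec2: _ => [|i _ y _ <-] //; exact: ipL.
Qed.

Lemma ip_linr a u v w : ip w (a *: u + v) = conj a * ip w u + ip w v.
Proof.
case: ipP => ipL ipC _.
by rewrite ipC ipL rmorphD rmorphM -!ipC.
Qed.

Lemma ip_sumr n (a : 'I_n -> K) (u : 'I_n -> V) w :
  ip w (\sum_i a i *: u i) = \sum_i conj (a i) * ip w (u i).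
Proof.
case: ipP => _ ipC _; rewrite ipC ip_suml rmorph_sum.
by apply: eq_bigr => i _; rewrite rmorphM -ipC.
Qed.

Lemma ip_conjK (v : V) : v != 0 -> involutive conj.
Proof.
case: ipP => ipL ipC ip_gt0 v0 z; have nz := lt0r_neq0 (ip_gt0 v v0).
have ipZ a : ip (a *: v) v = a * ip v v.
  by have := ip_suml (fun _ : 'I_1 => a) (fun=> v) v; rewrite !big_ord1.
have <- : ip ((z / ip v v) *: v) v = z by rewrite ipZ divfK.
by rewrite -!ipC.
Qed.

Lemma ip_inj u v : (forall w, ip w u = ip w v) -> u = v.
Proof.
case: ipP => _ _ ip_gt0 eq_uv; apply/eqP; rewrite -subr_eq0; apply/negPn/negP=> /ip_gt0.
by rewrite -[X in ip _ X]addrC -scaleN1r ip_linr rmorphN1 mulN1r eq_uv addNr ltxx.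
Qed.

End OneForm.

Variables (U V : vectType K) (ipU : U -> U -> K) (ipV : V -> V -> K).
Hypotheses (ipUP : is_inner_product conj ipU) (ipVP : is_inner_product conj ipV).
Variable f : 'Hom(U, V).

Lemma adjoint_exists : exists g, is_adjoint ipU ipV f g.
Proof.
have [U0|U1] := eqVneq (\dim {:U}) 0%N.
  have U0E (u : U) : u = 0.
    by apply/eqP; rewrite -memv0; move/eqP: U0; rewrite dimv_eq0 => /eqP <-; rewrite memvf.
  have ip0 : forall w, ipV 0 w = 0.
    move=> w; have := ip_suml ipVP (fun i : 'I_0 => 0) (fun i => 0) w.
    by rewrite !big_ord0.
  have ip0' : forall w, ipU 0 w = 0.
    move=> w; have := ip_suml ipUP (fun i : 'I_0 => 0) (fun i => 0) w.
    by rewrite !big_ord0.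
  by exists 0 => v u; rewrite /inner (U0E u) linear0 ip0 ip0'.
have conjK : involutive conj.
  by apply: (ip_conjK ipUP (v := vpick {:U})); rewrite vpick0 -dimv_eq0.
pose b := vbasis {:U}.
pose G := \matrix_(i < \dim {:U}, j < \dim {:U}) ipU b`_i b`_j.
have Gunit : G \in unitmx.
  rewrite -row_free_unit -kermx_eq0; apply/negPn/negP=> /rowV0Pn[c].
  move=> /sub_kermxP cG c0.
  pose u := \sum_i c 0 i *: b`_i.
  have : u = 0.
    apply: (ip_inj ipUP) => w; rewrite (ip_sumr ipUP).
    case: (ipUP) => _ ipC _.
    have -> : \sum_i conj (c 0 i) * ipU w b`_i = conj (ipU u w).
      by rewrite (ip_suml ipUP) rmorph_sum; apply: eq_bigr => i _; rewrite rmorphM -ipC.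
    rewrite (coord_vbasis (memvf w)) (ip_sumr ipUP) big1 => [|j _].
      have := ip_sumr ipUP (fun i : 'I_0 => 0) (fun i => 0) (\sum_(i < \dim {:U}) coord (vbasis {:U}) i w *: (vbasis {:U})`_i).
      by rewrite !big_ord0 rmorph0 => ->.
    rewrite (ip_suml ipUP).
    have -> : \sum_i c 0 i * ipU b`_i b`_j = (c *m G) 0 j.
      by rewrite mxE; apply: eq_bigr => i _; rewrite mxE.
    by rewrite cG mxE mulr0.
  move=> u0; case/negP: c0; apply/eqP/rowP=> i; rewrite mxE.
  by move/freeP: (basis_free (vbasisP {:U})); apply.
pose r v : 'cV[K]_(\dim {:U}) := \col_i ipV (f b`_i) v.
pose g v := \sum_l conj ((invmx G *m r v) l 0) *: b`_l.
have g_lin : linear g.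
  move=> a v w; rewrite /g scaler_sumr -big_split; apply: eq_bigr => l _ /=.
  rewrite scalerA -scalerDl; congr (_ *: _).
  have -> : r (a *: v + w) = conj a *: r v + r w.
    by apply/colP=> i; rewrite !mxE (ip_linr ipVP).
  by rewrite mulmxDr -scalemxAr !mxE rmorphD rmorphM conjK.
pose gL : {linear V -> U} :=
  HB.pack g (GRing.isSemilinear.Build _ _ _ _ g (GRing.semilinear_linear g_lin)).
exists (linfun gL) => v u; rewrite /inner lfunE /= /g (ip_sumr ipUP) /=.
rewrite {2}(coord_vbasis (memvf u)) linear_sum.
under [in RHS]eq_bigr => i _ do rewrite linearZ /=.
under eq_bigr => l _ do rewrite conjK {1}(coord_vbasis (memvf u)) (ip_suml ipUP) mulr_sumr.
rewrite (ip_suml ipVP) exchange_big; apply: eq_bigr => i _ /=.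
have /colP/(_ i) : G *m (invmx G *m r v) = r v by rewrite mulKVmx.
rewrite !mxE => <-; rewrite mulr_sumr; apply: eq_bigr => l _.
by rewrite mulrCA -/b [G _ _]mxE; congr (_ * _); rewrite mulrC.
Qed.

Lemma adjointP : is_adjoint ipU ipV f (adjoint ipU ipV f).
Proof. exact: xgetPex adjoint_exists. Qed.

Lemma adjoint_unique g : is_adjoint ipU ipV f g -> g = adjoint ipU ipV f.
Proof.
move=> gP; apply/lfunP=> v; apply: (ip_inj ipUP) => u.
by have := gP v u; rewrite -adjointP.
Qed.

End AdjointTheory.

Lemma dsum_inner_product (R : realType) (K : numFieldType)
    (conj : {rmorphism K -> K}) (hK : real_or_complex R conj) (V : vectType K)
    (ip : {dot V for conj}) (W : {vspace V}) (k : nat) :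
  is_inner_product conj (@dsum_ip K conj V ip W k).
Proof.
have [conjK conjN] := real_or_complex_norm hK.
have [ipL ipC ip_gt0] := dot_inner_product ip.
split=> [a u v w|u v|[u t] nz]; rewrite /dsum_ip.
- rewrite -[(a *: u + v).1]/(a *: u.1 + v.1) -[(a *: u + v).2]/(a *: u.2 + v.2).
  rewrite linearP ipL mulrDr addrACA; congr (_ + _).
  rewrite mulr_sumr -big_split; apply: eq_bigr => i _ /=.
  by rewrite !mxE mulrDl mulrA.
- rewrite rmorphD -ipC rmorph_sum; congr (_ + _).
  by apply: eq_bigr => i _; rewrite rmorphM conjK mulrC.
rewrite /=; under eq_bigr => i _ do rewrite conjN.
have [u0|u0] := eqVneq u 0.
  have v0 : vsval u = 0 by rewrite u0 linear0.
  have ip00 : ip 0 0 = 0 by rewrite linear0r.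
  rewrite v0 ip00 add0r lt_neqAle sumr_ge0 ?andbT; last first.
    by move=> i _; rewrite exprn_ge0.
  apply: contraNneq nz => /esym/eqP; rewrite psumr_eq0 => [/allP t0|i _]; last exact: exprn_ge0.
  rewrite u0; apply/eqP; congr (_, _); apply/rowP=> i; rewrite mxE; apply/eqP.
  by have := t0 i (mem_index_enum i); rewrite /= expf_eq0 normr_eq0.
rewrite ltr_wpDr ?sumr_ge0 // => [i _|]; first exact: exprn_ge0.
apply: ip_gt0; apply: contra u0 => /eqP u0; apply/eqP.
by apply: (can_inj (@vsvalK _ _ W)); rewrite u0 linear0.
Qed.

Section Linfun.
Variables (K : numFieldType) (E F : vectType K) (bd : 'Hom(E, F)).

Lemma transposeE (f : 'Hom(F, K^o)) : transpose bd f = (f \o bd)%VF.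
Proof.
have tlin : linear (fun f : 'Hom(F, K^o) => (f \o bd)%VF).
  by move=> a u v; rewrite comp_lfunDl comp_lfunZl.
pose tL : {linear 'Hom(F, K^o) -> 'Hom(E, K^o)} :=
  HB.pack (fun f : 'Hom(F, K^o) => (f \o bd)%VF)
    (GRing.isSemilinear.Build _ _ _ _ _ (GRing.semilinear_linear tlin)).
exact: (lfunE tL).
Qed.

Variables (conj : {rmorphism K -> K}) (ipF : {dot 'Hom(F, K^o) for conj}).
Variables (k : nat) (theta : k.-tuple 'Hom(E, K^o)).

Lemma dsum_mapE p : dsum_map bd ipF theta p =
  transpose bd (vsval p.1) + \sum_(i < k) p.2 0 i *: tnth theta i.
Proof.
pose h := fun p : (subvs_of (orthov ipF (lker (transpose bd))) * 'rV[K]_k)%type =>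
  transpose bd (vsval p.1) + \sum_(i < k) p.2 0 i *: tnth theta i.
have hlin : linear h.
  move=> a u v; rewrite /h -[(a *: u + v).1]/(a *: u.1 + v.1).
  rewrite -[(a *: u + v).2]/(a *: u.2 + v.2) !linearP scalerDr addrACA; congr (_ + _).
  rewrite scaler_sumr -big_split; apply: eq_bigr => i _ /=.
  by rewrite !mxE scalerDl scalerA.
pose hL : {linear _ -> 'Hom(E, K^o)} :=
  HB.pack h (GRing.isSemilinear.Build _ _ _ _ _ (GRing.semilinear_linear hlin)).
exact: (lfunE hL).
Qed.

End Linfun.

Lemma orthprojP (K : numFieldType) (conj : {rmorphism K -> K}) (V : vectType K)
    (ip : {dot V for conj}) (W : {vspace V}) (v : V) :
  orthproj ip W v \in W /\ v - orthproj ip W v \in orthov ip W.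
Proof.
have ipP := dot_inner_product ip.
have ipsP : is_inner_product conj (fun u v : subvs_of W => ip (vsval u) (vsval v)).
  case: ipP => ipL ipC ip_gt0; split=> [a u w z|u w|u u0].
  - by rewrite linearP ipL.
  - exact: ipC.
  apply: ip_gt0; apply: contra u0 => /eqP u0; apply/eqP.
  by apply: (can_inj (@vsvalK _ _ W)); rewrite u0 linear0.
have capW : (W :&: orthov ip W = 0)%VS.
  apply/eqP; rewrite -subv0; apply/subvP=> u; rewrite memv_cap memv0 => /andP[uW /mem_orthovP uWo].
  apply/negPn/negP=> u0; case: ipP => _ _ /(_ u u0).
  by rewrite uWo // ltxx.
have [g gP] := adjoint_exists ipsP ipP (linfun (vsval : subvs_of W -> V)).
have gW u : u - vsval (g u) \in orthov ip W.
  apply/mem_orthovP => w wW; have := gP u (vsproj W w).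
  rewrite /inner lfunE /= vsprojK // => eq_w.
  have [_ ipC _] := ipP.
  by rewrite linearBl /= ipC -[ip w u]eq_w -ipC subrr.
split; first exact: memv_pi.
have vW : v \in (W + orthov ip W)%VS.
  by rewrite -[v](subrK (vsval (g v))) addrC memv_add ?subvsP.
rewrite -[X in X - _](daddv_pi_add capW vW) /orthproj addrC addKr.
exact: memv_pi.
Qed.

Lemma ksubset_nth_inj k m (I : ksubset k m) : injective (ksubset_nth I).
Proof. by move=> i j /enum_val_inj /cast_ord_inj. Qed.

Lemma ksubset_nthE k m (I : ksubset k m) : ksubset_nth I @: [set: 'I_k] = val I.
Proof.
apply/eqP; rewrite eqEcard card_imset ?cardsT ?card_ord ?(eqP (valP I)) ?leqnn;
  last exact: ksubset_nth_inj.
by rewrite andbT; apply/fintype.subsetP=> _ /imsetP[j _ ->]; exact: enum_valP.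
Qed.

Section CauchyBinet.
Variables (R : comNzRingType) (k m : nat).

Let h (p : ksubset k m * 'S_k) : {ffun 'I_k -> 'I_m} :=
  [ffun i => ksubset_nth p.1 (p.2 i)].

Let h_inj : injective h.
Proof.
move=> [I s] [J t] /ffunP hE; have eqIJ : I = J.
  apply: val_inj; rewrite -!ksubset_nthE; apply/setP=> a.
  apply/imsetP/imsetP=> -[j _ ->].
    by exists (t (s^-1 j)%g) => //; have := hE (s^-1 j)%g; rewrite !ffunE /= permKV.
  by exists (s (t^-1 j)%g) => //; have := hE (t^-1 j)%g; rewrite !ffunE /= permKV.
rewrite -eqIJ in hE *; congr (_, _); apply/permP=> i; apply: (@ksubset_nth_inj _ _ I).
by have := hE i; rewrite !ffunE.
Qed.

Let h_img : h @: [set: ksubset k m * 'S_k] = [set f : {ffun 'I_k -> 'I_m} | injectiveb f].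
Proof.
apply/eqP; rewrite eqEcard; apply/andP; split.
  apply/fintype.subsetP=> _ /imsetP[[I s] _ ->]; rewrite inE; apply/injectiveP=> i j.
  by rewrite !ffunE /= => /ksubset_nth_inj /perm_inj.
rewrite card_inj_ffuns card_imset // cardsT card_prod card_Sn card_sig !card_ord.
by rewrite -bin_ffact leq_mul2r -[X in (_ <= X)%N]cardsE card_draws card_ord leqnn orbT.
Qed.

Lemma Cauchy_Binet (A : 'M[R]_(k, m)) (B : 'M[R]_(m, k)) :
  \det (A *m B) = \sum_(I : ksubset k m)
    \det (colsub (ksubset_nth I) A) * \det (rowsub (ksubset_nth I) B).
Proof.
transitivity (\sum_(f : {ffun 'I_k -> 'I_m})
    (\prod_i A i (f i)) * \det (rowsub f B)).
  rewrite /determinant; under eq_bigr => s _ do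
    under eq_bigr => i _ do rewrite mxE.
  under eq_bigr => s _ do rewrite bigA_distr_bigA mulr_sumr.
  rewrite exchange_big; apply: eq_bigr => f _ /=.
  rewrite mulr_sumr; apply: eq_bigr => s _.
  rewrite big_split /= mulrCA; congr (_ * (_ * _)).
  by apply: eq_bigr => i _; rewrite mxE.
rewrite (bigID (fun f => f \in [set f : {ffun 'I_k -> 'I_m} | injectiveb f])) /= [X in _ + X]big1; last first.
  move=> f; rewrite inE => /injectivePn[i [j neq_ij eq_f]].
  by rewrite (determinant_alternate neq_ij) ?mulr0 // => a; rewrite !mxE eq_f.
rewrite addr0 -h_img big_imset /=; last by move=> ? ? _ _; exact: h_inj.
rewrite (eq_bigl predT) => [|p]; last by rewrite inE.
rewrite -(pair_big predT predT (fun I s => \prod_i A i (h (I, s) i) *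
   \det (rowsub (h (I, s)) B))) /=.
apply: eq_bigr => I _; rewrite mulr_suml; apply: eq_bigr => s _.
have -> : rowsub (h (I, s)) B = row_perm s (rowsub (ksubset_nth I) B).
  by apply/matrixP=> i j; rewrite !mxE ffunE.
rewrite row_permE det_mulmx det_perm mulrA; congr (_ * _).
by rewrite mulrC; congr (_ * _); apply: eq_bigr => i _; rewrite !mxE ffunE.
Qed.

End CauchyBinet.

Section ExtTheory.
Variables (K : numFieldType) (conj : {rmorphism K -> K}) (V : vectType K).
Variable k : nat.
Local Notation b := (vbasis {:V}).

Lemma wedgeE (u : 'I_k -> V) I :
  wedge u I = \det (colsub (ksubset_nth I) (\matrix_(i, j) coord b j (u i))).
Proof. by rewrite ffunE; congr (\det _); apply/matrixP=> i j; rewrite !mxE. Qed.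

Lemma ext_map_wedge (f : 'End(V)) (u : 'I_k -> V) :
  ext_map f (wedge u) = wedge (f \o u).
Proof.
apply/ffunP=> J; rewrite ffunE wedgeE.
pose U : 'M_(k, \dim {:V}) := \matrix_(i, j) coord b j (u i).
pose M : 'M_(\dim {:V}, k) := \matrix_(i, j) coord b (ksubset_nth J j) (f b`_i).
have -> : colsub (ksubset_nth J) (\matrix_(i, j) coord b j ((f \o u) i)) = U *m M.
  apply/matrixP=> i j; rewrite !mxE /= {1}(coord_vbasis (memvf (u i))) !linear_sum.
  by apply: eq_bigr => l _; rewrite !linearZ /= !mxE.
rewrite Cauchy_Binet; apply: eq_bigr => I _; rewrite wedgeE; congr (_ * _).
by rewrite ffunE; congr (\det _); apply/matrixP=> i j; rewrite !mxE.
Qed.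

Lemma ext_ip_wedge (ip : {dot V for conj}) (u v : 'I_k -> V) :
  ext_ip ip (wedge u) (wedge v) = \det (\matrix_(i < k, j < k) ip (u i) (v j)).
Proof.
pose U (u : 'I_k -> V) : 'M_(k, \dim {:V}) := \matrix_(i, j) coord b j (u i).
pose G := \matrix_(i < \dim {:V}, j < \dim {:V}) ip b`_i b`_j.
have -> : \matrix_(i, j) ip (u i) (v j) = U u *m (G *m (map_mx conj (U v))^T).
  apply/matrixP=> i j; rewrite !mxE {1}(coord_vbasis (memvf (u i))) linear_sumlz.
  apply: eq_bigr => l _; rewrite linearZl_LR !mxE; congr (_ * _).
  rewrite {1}(coord_vbasis (memvf (v j))) linear_sumr.
  by apply: eq_bigr => n _; rewrite linearZr_LR /= !mxE mulrC.
rewrite Cauchy_Binet; apply: eq_bigr => I _; rewrite -wedgeE.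
have -> : rowsub (ksubset_nth I) (G *m (map_mx conj (U v))^T) =
    rowsub (ksubset_nth I) G *m (map_mx conj (U v))^T by rewrite mul_rowsub_mx.
rewrite Cauchy_Binet mulr_sumr; apply: eq_bigr => J _.
rewrite -mulrA [X in _ * X]mulrC; congr (_ * (_ * _)).
  by congr (\det _); apply/matrixP=> i j; rewrite !mxE.
by rewrite wedgeE -det_map_mx -det_tr; congr (\det _); apply/matrixP=> i j; rewrite !mxE.
Qed.

End ExtTheory.

(* Main.v *)
Require Import Defs.
From mathcomp Require Import all_boot all_order all_fingroup all_algebra.
From mathcomp Require Import sesquilinear boolp classical_sets reals ring.

(** Let W be the orthogonal complement of ker d, with basis g_1, ..., g_n, and let
gamma be the Gram determinant of (g_a). Write D for the matrix with entries
(d g_a)(e_i), and M for D followed by the rows theta_i(e_j). Computing the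
determinant of an endomorphism from Gram matrices gives
w(T) = |det D_T|^2 / gamma for every basis T, and
det Delta = Gram(d g, theta) / gamma. If J of cardinality n + k contains a basis T,
replacing the columns of M_J outside T by the projections on ker bd along E_T gives
|det M_J| = |det D_T| |(theta, det Z)|, so w(J) = |det M_J|^2 / gamma, while
det M_J = 0 when J contains no basis. Cauchy-Binet then turns the sum over J into
Gram(d g, theta) / gamma. Since theta_i and its projection on ker d^* differ by an
element of im d, Gram(d g, theta) = Gram(d g) Gram(Pi theta). *)

Set Implicit Arguments.
Unset Strict Implicit.
Unset Printing Implicit Defensive.

Import Order.TTheory GRing.Theory Num.Theory.
Local Open Scope ring_scope.

(** * Gram matrices and determinants of endomorphisms *)

Definition gram (K : numFieldType) (V : vectType K) (ip : V -> V -> K) (m p : nat)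
    (u : 'I_m -> V) (v : 'I_p -> V) : 'M[K]_(m, p) :=
  \matrix_(i, j) ip (u i) (v j).

Section Gram.
Variables (K : numFieldType) (conj : {rmorphism K -> K}) (V : vectType K).
Variables (ip : V -> V -> K) (ipP : is_inner_product conj ip).

Lemma gram_suml m p q (A : 'M[K]_(m, p)) (u : 'I_p -> V) (v : 'I_q -> V) :
  gram ip (fun i => \sum_j A i j *: u j) v = A *m gram ip u v.
Proof.
apply/matrixP=> i j; rewrite !mxE (ip_suml ipP).
by apply: eq_bigr => l _; rewrite mxE.
Qed.

Lemma gram_conj m p (u : 'I_m -> V) (v : 'I_p -> V) :
  gram ip u v = (map_mx conj (gram ip v u))^T.
Proof. by case: ipP => _ ipC _; apply/matrixP=> i j; rewrite !mxE ipC. Qed.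

Lemma det_gram_conj m (u v : 'I_m -> V) :
  conj (\det (gram ip u v)) = \det (gram ip v u).
Proof. by rewrite (gram_conj v) det_tr det_map_mx. Qed.

Lemma ip0_eq0 u : ip u u = 0 -> u = 0.
Proof.
case: ipP => _ _ ip_gt0 uu0; apply/eqP/negPn/negP=> /ip_gt0.
by rewrite uu0 ltxx.
Qed.

(** A row [c] killed by the Gram matrix makes the combination of the [u i] with coefficients [c]
    orthogonal to itself, hence zero, and freeness gives [c = 0]. *)
Lemma det_gram_free m (u : m.-tuple V) : free u ->
  \det (gram ip (tnth u) (tnth u)) != 0.
Proof.
move=> /freeP freeu; rewrite -unitfE -unitmxE -row_free_unit -kermx_eq0.
apply/negPn/negP=> /rowV0Pn[c /sub_kermxP cG /eqP[]].
apply/rowP=> i; rewrite [RHS]mxE; apply: freeu.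
under eq_bigr => j _ do rewrite -tnth_nth.
apply: ip0_eq0; rewrite (ip_sumr ipP) big1 // => j _.
rewrite (ip_suml ipP); suff -> : \sum_l c 0 l * ip (tnth u l) (tnth u j) = 0 by rewrite mulr0.
transitivity ((c *m gram ip (tnth u) (tnth u)) 0 j); last by rewrite cG mxE.
by rewrite mxE; apply: eq_bigr => l _; rewrite mxE.
Qed.

(** With P the square matrix of coordinates of [u] in [vbasis], the two Gram matrices are P G and P
    A G, where A is the matrix of [f]. Thus [lfun_det f] can be computed from any families whose
    Gram determinant is nonzero, and no change of basis is needed. *)
Lemma lfun_det_gram m (f : 'End(V)) (u v : 'I_m -> V) : m = \dim {:V} ->
  \det (gram ip (f \o u) v) = lfun_det f * \det (gram ip u v).
Proof.
move=> mE; move: u v; rewrite {}mE => u v.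
pose b := vbasis {:V}.
pose P : 'M_(\dim {:V}) := \matrix_(i, j) coord b j (u i).
have uE i : u i = \sum_j P i j *: tnth b j.
  rewrite {1}(coord_vbasis (memvf (u i))); apply: eq_bigr => j _.
  by rewrite mxE (tnth_nth 0).
have fE i : f (tnth b i) = \sum_j passmx.mxof b b f i j *: tnth b j.
  rewrite {1}(coord_vbasis (memvf (f (tnth b i)))); apply: eq_bigr => j _.
  rewrite !(tnth_nth 0) passmx.coord_rVof (passmx.rVof_app _ (vbasisP _)).
  by rewrite passmx.rVofE ?vbasisP // -rowE [row _ _ _ _]mxE.
have -> : gram ip u v = P *m gram ip (tnth b) v.
  by rewrite -gram_suml; congr gram; apply: funext => i.
have -> : gram ip (f \o u) v = P *m (passmx.mxof b b f *m gram ip (tnth b) v).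
  rewrite -!gram_suml; congr gram; apply: funext => i /=.
  by rewrite uE linear_sum; apply: eq_bigr => j _; rewrite linearZ /= fE.
by rewrite !det_mulmx /lfun_det mulrCA.
Qed.

End Gram.

(** * Sums over subsets of fixed size and the weighted Cauchy-Binet formula *)

Lemma sum_ksubset (K : nmodType) (m p : nat) (F : {set 'I_p} -> K) :
  \sum_(J : {set 'I_p} | #|J| == m) F J = \sum_(I : ksubset m p) F (val I).
Proof. by rewrite (big_sub (fun J : {set 'I_p} => #|J| == m)). Qed.

Lemma prod_ksubset (K : comPzRingType) (m p : nat) (I : ksubset m p) (x : 'I_p -> K) :
  \prod_(j < m) x (ksubset_nth I j) = \prod_(i in val I) x i.
Proof.
rewrite -ksubset_nthE big_imset /=; last by move=> i j _ _ /ksubset_nth_inj.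
by apply: eq_bigl => j; rewrite inE.
Qed.

Section Conjugation.
Variables (K : numFieldType) (conj : {rmorphism K -> K}).
Hypothesis conjN : forall z, z * conj z = `|z| ^+ 2.

Lemma conj_ge0 z : 0 <= z -> conj z = z.
Proof.
rewrite le_eqVlt => /predU1P[<-|z_gt0]; first exact: rmorph0.
by apply: (mulfI (lt0r_neq0 z_gt0)); rewrite conjN gtr0_norm.
Qed.

Lemma conj_id_real z : conj z = z -> z \is Num.real.
Proof.
move=> zc; have /eqP := conjN z; rewrite zc -expr2 eqf_sqr.
by case/orP=> /eqP->; rewrite ?rpredN normr_real.
Qed.

(** Since [f] is injective, it is [g] composed with a permutation. The two minors differ by its
    sign, which the norm removes. *)
Lemma norm_det_colsub m p (A : 'M[K]_(m, p)) (f g : 'I_m -> 'I_p) :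
  injective f -> (forall i, exists j, f i = g j) ->
  `|\det (colsub f A)| = `|\det (colsub g A)|.
Proof.
move=> f_inj /choice[h hP].
have h_inj : injective h by move=> i j hij; apply: f_inj; rewrite !hP hij.
have -> : colsub f A = col_perm (perm h_inj) (colsub g A).
  by apply/matrixP=> i j; rewrite !mxE permE -hP.
by rewrite col_permE det_mulmx det_perm normrM normrX normrN1 expr1n mulr1.
Qed.

(** Cauchy-Binet for [A] times diag(x) times the conjugate transpose of [A]. The left side is the
    Gram matrix of forms whose coordinates in an orthogonal basis of weights [x] are the rows of
    [A]. *)
Lemma det_weighted_gram m p (A : 'M[K]_(m, p)) (x : 'I_p -> K) :
  \det (\matrix_(i, j) \sum_l A i l * x l * conj (A j l)) =
  \sum_(I : ksubset m p)
    `|\det (colsub (ksubset_nth I) A)| ^+ 2 * \prod_(i in val I) x i.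
Proof.
pose B : 'M_(p, m) := \matrix_(l, j) (x l * conj (A j l)).
have -> : \matrix_(i, j) \sum_l A i l * x l * conj (A j l) = A *m B.
  by apply/matrixP=> i j; rewrite !mxE; apply: eq_bigr => l _; rewrite mxE mulrA.
rewrite Cauchy_Binet; apply: eq_bigr => I _.
have -> : rowsub (ksubset_nth I) B = diag_mx (\row_j x (ksubset_nth I j)) *m
    (map_mx conj (colsub (ksubset_nth I) A))^T.
  by rewrite mul_diag_mx; apply/matrixP=> i j; rewrite !mxE.
rewrite det_mulmx det_diag det_tr det_map_mx mulrCA mulrC conjN; congr (_ * _).
by rewrite -prod_ksubset; apply: eq_bigr => j _; rewrite mxE.
Qed.

End Conjugation.

(** * Bases of the matroid and the decomposition of E along ker bd *)

Lemma free_mktuple (K : fieldType) (V : vectType K) n (u : 'I_n -> V) :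
  (forall c : 'I_n -> K, \sum_i c i *: u i = 0 -> forall i, c i = 0) ->
  free [seq u i | i <- enum 'I_n].
Proof.
move=> uP; rewrite -[X in free X]/(val [tuple u i | i < n]).
apply/freeP=> c c0; apply: uP; rewrite -[RHS]c0.
by apply: eq_bigr => i _; rewrite -tnth_nth tnth_mktuple.
Qed.

Section Independence.
Variables (K : numFieldType) (s : nat) (E F : vectType K).
Variables (e : s.-tuple E) (he : basis_of {:E} e) (bd : 'Hom(E, F)).

Lemma dim_span_bd T : indep e bd T ->
  \dim <<[seq bd (tnth e i) | i <- enum T]>> = #|T|.
Proof. by move=> /eqP->; rewrite size_map cardE. Qed.

Lemma span_bd_sub (T : {set 'I_s}) : (<<[seq bd (tnth e i) | i <- enum T]>> <= limg bd)%VS.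
Proof. by apply/span_subvP=> _ /mapP[i _ ->]; rewrite memv_img ?memvf. Qed.

(** By maximality, the span of the [bd (tnth e i)] with i in [T] contains every [bd (tnth e j)], so
    it is the whole image of [bd]. *)
Lemma card_bases T : T \in bases e bd -> #|T| = \dim (limg bd).
Proof.
rewrite inE => /maxsetP[indT maxT]; rewrite -(dim_span_bd indT).
congr (\dim _); apply/eqP; rewrite eqEsubv span_bd_sub -(span_basis he) limg_span.
apply/span_subvP=> _ /mapP[_ /tnthP[j ->] ->]; apply/negPn/negP=> Nj.
have jT : j \notin T.
  by apply: contra Nj => jT; apply/memv_span/mapP; exists j; rewrite ?mem_enum.
suff : indep e bd (j |: T).
  by move=> /maxT/(_ (finset.subsetUr _ _))/finset.setP/(_ j); rewrite finset.setU11 (negPf jT).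
have /perm_free perm_jT : perm_eq [seq bd (tnth e i) | i <- enum (j |: T)]
    [seq bd (tnth e i) | i <- j :: enum T].
  apply/perm_map/uniq_perm; rewrite /= ?enum_uniq ?mem_enum ?jT // => i.
  by rewrite inE !mem_enum !inE.
by rewrite /indep perm_jT /= free_cons Nj.
Qed.

Lemma indep_card_bases T :
  indep e bd T -> #|T| = \dim (limg bd) -> T \in bases e bd.
Proof.
move=> indT cT; rewrite inE; apply/maxsetP; split=> // B indB sTB.
apply/eqP; rewrite eq_sym eqEcard sTB cT -(dim_span_bd indB).
exact/dimvS/span_bd_sub.
Qed.

Section Complement.
Variable (T : {set 'I_s}).
Hypothesis baseT : T \in bases e bd.

(** Rank-nullity on E_T: the image under [bd] already has dimension [#|T|], and E_T is spanned by
    [#|T|] vectors, so nothing is left for the kernel. *)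
Lemma span_on_cap_ker : (lker bd :&: span_on e T)%VS = 0%VS.
Proof.
have indT : indep e bd T by move: baseT; rewrite inE => /maxsetp.
have := limg_ker_dim bd (span_on e T); rewrite limg_span -map_comp dim_span_bd //.
have := dim_span [seq tnth e j | j <- enum T]; rewrite size_map -cardE => dT dE.
apply/eqP; rewrite -dimv_eq0 capvC -leqn0 -(leq_add2r #|T|) dE; exact: dT.
Qed.

Lemma span_on_add_ker : (lker bd + span_on e T)%VS = fullv.
Proof.
have indT : indep e bd T by move: baseT; rewrite inE => /maxsetp.
apply/eqP; rewrite -(dimv_leqif_eq (subvf _)).
rewrite (dimv_disjoint_sum span_on_cap_ker) -(limg_ker_dim bd fullv) capfv eqn_add2l.
rewrite -(limg_ker_dim bd (span_on e T)) capvC span_on_cap_ker dimv0 add0n.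
by rewrite limg_span -map_comp dim_span_bd // card_bases.
Qed.

Lemma proj_ker_in v : proj_ker e bd T v \in lker bd.
Proof. exact: memv_pi. Qed.

Lemma sub_proj_ker_in v : v - proj_ker e bd T v \in span_on e T.
Proof.
have vE : v \in (lker bd + span_on e T)%VS by rewrite span_on_add_ker memvf.
rewrite -[X in X - _](daddv_pi_add span_on_cap_ker vE) /proj_ker addrC addKr.
exact: memv_pi.
Qed.

End Complement.
End Independence.

(** * Coordinates in the dual basis *)

Section DualBasis.
Variables (K : numFieldType) (s : nat) (E : vectType K).
Variables (e : s.-tuple E) (he : basis_of {:E} e).

Lemma dual_vecE i j : dual_vec e i (tnth e j) = (i == j)%:R.
Proof.
by rewrite /dual_vec lfunE /= (tnth_nth 0) coord_free ?(basis_free he) // eq_sym.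
Qed.

Lemma dual_vec_expand (u : 'Hom(E, K^o)) : u = \sum_i u (tnth e i) *: dual_vec e i.
Proof.
apply/lfunP=> v; rewrite (coord_basis he (memvf v)) !linear_sum.
apply: eq_bigr => j _; rewrite !linearZ /= -tnth_nth; congr (_ *: _).
rewrite sum_lfunE (bigD1 j) //= big1 ?addr0 => [|i ij].
  by rewrite scale_lfunE dual_vecE eqxx [LHS](esym (mulr1 _)).
by rewrite scale_lfunE dual_vecE (negPf ij) scaler0.
Qed.

Lemma dual_span_dim m (I : ksubset m s) : \dim (dual_span e (val I)) = m.
Proof.
rewrite -[RHS](eqP (valP I)) cardE -(size_map (dual_vec e)).
apply/eqP; rewrite -/(free _).
(* Freeness passes to the family over [val I] from the full dual family, listed with [val I] first
   and its complement after. *)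
apply: (@catl_free _ _ [seq dual_vec e i | i <- enum (~: val I)]).
rewrite -map_cat.
have /perm_free-> : perm_eq [seq dual_vec e i | i <- enum (val I) ++ enum (~: val I)]
    [seq dual_vec e i | i <- enum 'I_s].
  apply/perm_map/uniq_perm; rewrite ?enum_uniq //.
    rewrite cat_uniq !enum_uniq andbT /=; apply/hasPn=> i.
    by rewrite !mem_enum inE.
  by move=> i; rewrite mem_cat !mem_enum inE orbN.
apply: free_mktuple => c c0 i; have := congr1 (fun u : 'Hom(E, K^o) => u (tnth e i)) c0.
rewrite sum_lfunE zero_lfunE (bigD1 i) //= big1 ?addr0 => [|j ji].
  by rewrite scale_lfunE dual_vecE eqxx => <-; rewrite [LHS](esym (mulr1 _)).
by rewrite scale_lfunE dual_vecE (negPf ji) scaler0.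
Qed.

Variables (conj : {rmorphism K -> K}) (x : 'I_s -> K).
Variable (ipE : {dot 'Hom(E, K^o) for conj}).
Hypothesis hip : orthogonal_dual_basis e x ipE.

Lemma dual_ipE (u v : 'Hom(E, K^o)) :
  ipE u v = \sum_i u (tnth e i) * x i * conj (v (tnth e i)).
Proof.
have ipP := dot_inner_product ipE.
rewrite {1}(dual_vec_expand u) (ip_suml ipP); apply: eq_bigr => i _.
rewrite {1}(dual_vec_expand v) (ip_sumr ipP) -mulrA; congr (_ * _).
rewrite (bigD1 i) //= big1 ?addr0 => [|j ji]; have := hip.
  by move=> /(_ i i); rewrite /inner eqxx => ->; rewrite mulrC.
by move=> /(_ j i); rewrite /inner (negPf ji) => ->; rewrite mulr0.
Qed.

Lemma dual_ip_vec (u : 'Hom(E, K^o)) i : ipE u (dual_vec e i) = u (tnth e i) * x i.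
Proof.
rewrite dual_ipE (bigD1 i) //= big1 ?addr0 => [|j ji]; rewrite dual_vecE.
  by rewrite eqxx rmorph1 mulr1.
by rewrite eq_sym (negPf ji) rmorph0 mulr0.
Qed.

End DualBasis.

(** * The minors of D and M, and the matroid *)

Lemma orthproj_cap (K : numFieldType) (conj : {rmorphism K -> K}) (V : vectType K)
    (ip : {dot V for conj}) (W : {vspace V}) : (W :&: orthov ip W = 0)%VS.
Proof.
apply/eqP; rewrite -subv0; apply/subvP=> u; rewrite memv_cap memv0.
case/andP=> uW /mem_orthovP uWo; apply/eqP.
exact: (ip0_eq0 (dot_inner_product ip) (uWo u uW)).
Qed.

Section DualRestriction.
Variables (K : numFieldType) (s : nat) (E F : vectType K).
Variables (e : s.-tuple E) (he : basis_of {:E} e) (bd : 'Hom(E, F)).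
Variables (conj : {rmorphism K -> K}) (ipF : {dot 'Hom(F, K^o) for conj}).

Local Notation d := (transpose bd).
Local Notation W := (orthov ipF (lker d)).

Lemma transpose_orthov f : exists2 h, h \in W & d f = d h.
Proof.
have [] := orthprojP ipF (lker d) f; rewrite memv_ker => /eqP d0 hW.
by exists (f - orthproj ipF (lker d) f); rewrite // linearB /= d0 subr0.
Qed.

(** A form is killed by d exactly when it vanishes on the image of [bd]. So ker d is the kernel of
    the restriction map [r] from F* to the dual of that image, and [r] is onto. *)
Lemma dim_orthov_ker : \dim W = \dim (limg bd).
Proof.
pose U := limg bd; pose r := transpose (linfun (vsval : subvs_of U -> F)).
have rE f (z : subvs_of U) : r f z = f (vsval z) by rewrite transposeE lfunE /= lfunE.
have dE f v : d f v = f (bd v) by rewrite transposeE lfunE.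
have kerE : lker d = lker r.
  apply/vspaceP=> f; rewrite !memv_ker; apply/eqP/eqP=> f0; apply/lfunP=> z.
    rewrite rE zero_lfunE; have /memv_imgP[v _ ->] := subvsP z.
    by rewrite -dE f0 zero_lfunE.
  have zU : bd z \in U by rewrite memv_img ?memvf.
  by rewrite dE zero_lfunE -[bd z](vsprojK zU) -rE f0 zero_lfunE.
have limgE : limg r = fullv.
  apply/eqP; rewrite eqEsubv subvf; apply/subvP=> f _.
  (* A form on U extends to F by composing it with the projection [vsproj U]. *)
  apply/memv_imgP; exists (f \o linfun (vsproj U))%VF; first exact: memvf.
  by apply/lfunP=> z; rewrite rE lfunE /= lfunE /= vsvalK.
have := limg_ker_dim r fullv; rewrite limgE capfv -kerE.
have <- : (lker d + W)%VS = fullv.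
  apply/eqP; rewrite eqEsubv subvf; apply/subvP=> f _.
  have [pK pW] := orthprojP ipF (lker d) f.
  by rewrite -[f](subrK (orthproj ipF (lker d) f)) addrC memv_add.
rewrite (dimv_disjoint_sum (orthproj_cap _ _)) => /eqP; rewrite eqn_add2l => /eqP <-.
by rewrite dimvf /dim /= muln1.
Qed.

Local Notation n := (\dim W).
Local Notation g := (tnth (vbasis W)).

Lemma orthov_expand h : h \in W -> exists c : 'I_n -> K, h = \sum_a c a *: g a.
Proof.
move=> hW; exists (fun a => coord (vbasis W) a h); rewrite {1}(coord_vbasis hW).
by apply: eq_bigr => a _; rewrite (tnth_nth 0).
Qed.

Lemma basis_in_orthov a : g a \in W.
Proof. exact/vbasis_mem/mem_tnth. Qed.

(** Row [a] lists the coordinates of [u a] in the dual basis. *)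
Definition evmx m (u : 'I_m -> 'Hom(E, K^o)) : 'M[K]_(m, s) :=
  \matrix_(a, i) (u a (tnth e i) : K).

Local Notation D := (evmx (d \o g)).

(** A nonzero minor has no repeated column, so [f] is injective, and a relation between the
    [bd (tnth e (f a))] would be a relation between its columns. The cardinality then makes this
    independent set a basis. *)
Lemma bases_imset f : \det (colsub f D) != 0 -> [set f a | a : 'I_n] \in bases e bd.
Proof.
move=> Df; have f_inj : injective f.
  move=> a b fab; apply/eqP/negPn/negP=> ab; case/eqP: Df.
  rewrite -det_tr (determinant_alternate ab) // => c.
  by rewrite !mxE fab.
apply: indep_card_bases => //; last by rewrite card_imset // card_ord dim_orthov_ker.
have /perm_free perm_f : perm_eq [seq bd (tnth e i) | i <- enum [set f a | a : 'I_n]]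
    [seq bd (tnth e (f a)) | a <- enum 'I_n].
  rewrite (map_comp (fun i => bd (tnth e i)) f); apply/perm_map/uniq_perm.
  - exact: enum_uniq.
  - by rewrite map_inj_uniq ?enum_uniq.
  move=> i; rewrite mem_enum; apply/imsetP/mapP=> -[a _ ->];
    by exists a; rewrite ?mem_enum.
rewrite /indep perm_f; apply: free_mktuple => c c0.
pose cv : 'cV[K]_n := \col_a c a.
have Dc : colsub f D *m cv = 0.
  apply/colP=> b; rewrite !mxE; transitivity (g b (\sum_a c a *: bd (tnth e (f a)))).
    rewrite linear_sum; apply: eq_bigr => a _.
    by rewrite !mxE /= linearZ transposeE lfunE /= mulrC.
  by rewrite c0 linear0.
move: Df; rewrite -unitfE -unitmxE => Du i.
by have /colP/(_ i) := congr1 (mulmx (invmx (colsub f D))) Dc; rewrite mulKmx // mulmx0 !mxE.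
Qed.

Section Theta.
Variables (k : nat) (theta : k.-tuple 'Hom(E, K^o)).
Local Notation M := (col_mx D (evmx (tnth theta))).

(** If M_I is invertible, its upper block D_I has full row rank, so n of its columns form a nonzero
    minor of D, and these columns index a basis. *)
Lemma det_neq0_sub_bases (I : ksubset (n + k) s) :
  \det (colsub (ksubset_nth I) M) != 0 ->
  exists2 T, T \in bases e bd & T \subset val I.
Proof.
rewrite -unitfE -unitmxE -row_free_unit => /row_freeP[B].
set N := ksubset_nth I => MB.
have full : row_full (colsub N D)^T.
  rewrite /row_full mxrank_tr -/(row_free _); apply/row_freeP.
  (* [B] is a right inverse of M_I; its first n columns give a right inverse of the upper block. *)
  exists (lsubmx B).
  have -> : colsub N D = usubmx (colsub N M).
    by apply/matrixP=> i j; rewrite [RHS]mxE [RHS]mxE col_mxEu !mxE.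
  by rewrite mulmx_lsub mul_usub_mx MB scalar_mx_block; exact: block_mxKul.
have := fullrowsub_unit full.
have -> : rowsub (fullrankfun full) (colsub N D)^T = (colsub (N \o fullrankfun full) D)^T.
  by apply/matrixP=> i j; rewrite !mxE.
rewrite unitmx_tr unitmxE unitfE => /bases_imset; set f := _ \o _ => fT.
exists [set f a | a : 'I_n] => //; apply/fintype.subsetP=> _ /imsetP[a _ ->].
by rewrite -(ksubset_nthE I); apply: imset_f; rewrite inE.
Qed.

(** Column elimination: modulo the columns in T, the column of e_j for j outside T becomes that of
    its projection on ker bd, where all the d g_a vanish. The result is block triangular with
    diagonal blocks D_T and the pairing matrix. *)
Lemma norm_det_sub_bases (I : ksubset (n + k) s) (T : ksubset n s) :
  val T \in bases e bd -> val T \subset val I ->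
  `|\det (colsub (ksubset_nth I) M)| =
  `|\det (colsub (ksubset_nth T) D)| * `|det_pairing theta (ker_basis e bd (val T) (val I))|.
Proof.
move=> bT sTI.
have cQ : #|val I :\: val T| == k.
  by rewrite cardsD (finset.setIidPr sTI) (eqP (valP I)) (eqP (valP T)) addKn.
pose Q : ksubset k s := Sub (val I :\: val T) cQ.
have QE b : ksubset_nth Q b \in val I :\: val T.
  by rewrite -[val I :\: val T]/(val Q) -(ksubset_nthE Q); apply: imset_f; rewrite inE.
have TE a : ksubset_nth T a \in val T by rewrite -(ksubset_nthE T); apply: imset_f; rewrite inE.
(* The columns of I are reordered with T first; this costs a sign at most, hence the norms. *)
pose phi i := match split i with inl a => ksubset_nth T a | inr b => ksubset_nth Q b end.
have phi_inj : injective phi.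
  move=> i j; rewrite /phi; case: splitP => [a ia|a ia]; case: splitP => [b jb|b jb] ab.
  - by apply: val_inj; rewrite /= ia jb (ksubset_nth_inj ab).
  - by have := QE b; rewrite -ab !inE TE.
  - by have := QE a; rewrite ab !inE TE.
  - by apply: val_inj; rewrite /= ia jb (ksubset_nth_inj ab).
have phiI i : exists j, phi i = ksubset_nth I j.
  have : phi i \in val I.
    rewrite /phi; case: splitP => a _; first exact: (fintype.subsetP sTI _ (TE a)).
    by have := QE a; rewrite !inE => /andP[].
  by rewrite -(ksubset_nthE I) => /imsetP[j _ ->]; exists j.
rewrite -(norm_det_colsub M phi_inj phiI).
pose z b := proj_ker e bd (val T) (tnth e (ksubset_nth Q b)).
pose X := [tuple tnth e (ksubset_nth T a) | a < n].
have spanX : span_on e (val T) = <<X>>%VS.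
  apply: eq_span => v; apply/mapP/mapP=> -[i iT ->].
    move: iT; rewrite mem_enum -(ksubset_nthE T) => /imsetP[a _ ->].
    by exists a; rewrite ?mem_enum.
  by exists (ksubset_nth T i); rewrite ?mem_enum.
(* The E_T-components of the e_j, j in I outside T, which are the coefficients of the
   elimination. *)
pose q : 'M[K]_(n, k) := \matrix_(a, b) coord X a (tnth e (ksubset_nth Q b) - z b).
have eE b : tnth e (ksubset_nth Q b) = \sum_a q a b *: tnth e (ksubset_nth T a) + z b.
  have zX : tnth e (ksubset_nth Q b) - z b \in <<X>>%VS.
    by rewrite -spanX sub_proj_ker_in.
  rewrite -[LHS](subrK (z b)); congr (_ + _); rewrite {1}(coord_span zX).
  by apply: eq_bigr => a _; rewrite mxE -tnth_nth tnth_mktuple.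
pose Z : 'M[K]_k := \matrix_(i, b) (tnth theta i (z b) : K).
have colQ m (u : 'I_m -> 'Hom(E, K^o)) :
    colsub (ksubset_nth Q) (evmx u) =
    colsub (ksubset_nth T) (evmx u) *m q + \matrix_(i, b) (u i (z b) : K).
  apply/matrixP=> i b; rewrite !mxE eE linearD linear_sum; congr (_ + _).
  by apply: eq_bigr => a _; rewrite linearZ !mxE /= mulrC.
have -> : colsub phi M =
    block_mx (colsub (ksubset_nth T) D) 0 (colsub (ksubset_nth T) (evmx (tnth theta))) Z
    *m block_mx 1%:M q 0 1%:M.
  rewrite mulmx_block !mulmx1 !mulmx0 !addr0.
  have Dz : \matrix_(i, b) ((d \o g) i (z b) : K) = 0 :> 'M_(n, k).
    apply/matrixP=> i b; rewrite !mxE /= transposeE lfunE /=.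
    by have /eqP-> : bd (z b) == 0; rewrite -?memv_ker ?proj_ker_in ?linear0.
  have := colQ _ (d \o g); rewrite Dz addr0 => <-; rewrite -colQ.
  apply/matrixP=> i j; rewrite !mxE; case: (split i) => a; rewrite !mxE /phi;
    by case: (split j) => b; rewrite !mxE.
rewrite det_mulmx det_lblock det_ublock !det1 !mulr1 normrM; congr (_ * `|\det _|).
apply/matrixP=> i b; rewrite !mxE; congr (tnth theta i _).
rewrite /ker_basis.
have bs : (b < size (enum (val I :\: val T)))%N by rewrite -cardE (eqP cQ).
(* The enumerations use different default values, which agree here because [b] is within range. *)
rewrite (nth_map (ksubset_nth Q b)) //=; congr (proj_ker _ _ _ (tnth e _)).
by rewrite /ksubset_nth /enum_val /=; apply: set_nth_default.
Qed.

End Theta.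
End DualRestriction.

(** * Concatenated families *)

Definition fcat (A : Type) m p (u : 'I_m -> A) (v : 'I_p -> A) (i : 'I_(m + p)) : A :=
  match split i with inl a => u a | inr b => v b end.

Lemma gram_fcat (K : numFieldType) (V : vectType K) (ip : V -> V -> K) m p
    (u : 'I_m -> V) (v : 'I_p -> V) :
  gram ip (fcat u v) (fcat u v) =
  block_mx (gram ip u u) (gram ip u v) (gram ip v u) (gram ip v v).
Proof.
apply/matrixP=> i j; rewrite !mxE /fcat.
by case: (split i) => a; rewrite !mxE; case: (split j) => b; rewrite !mxE.
Qed.

Lemma evmx_fcat (K : numFieldType) (s : nat) (E : vectType K) (e : s.-tuple E) m p
    (u : 'I_m -> 'Hom(E, K^o)) (v : 'I_p -> 'Hom(E, K^o)) :
  evmx e (fcat u v) = col_mx (evmx e u) (evmx e v).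
Proof.
by apply/matrixP=> i j; rewrite !mxE /fcat; case: (split i) => a; rewrite mxE.
Qed.

(** * Weights of bases through the compression of d d^* *)

Section Weights.
Variables (R : realType) (K : numFieldType) (conj : {rmorphism K -> K}).
Hypothesis hK : real_or_complex R conj.
Variables (s : nat) (E F : vectType K).
Variables (e : s.-tuple E) (he : basis_of {:E} e) (bd : 'Hom(E, F)).
Variable ipF : {dot 'Hom(F, K^o) for conj}.

Local Notation d := (transpose bd).
Local Notation W := (orthov ipF (lker d)).
Local Notation n := (\dim W).
Local Notation g := (tnth (vbasis W)).
Local Notation D := (evmx e (d \o g)).
Local Notation gamma := (\det (gram ipF g g)).

Let conjN : forall z, z * conj z = `|z| ^+ 2 := (real_or_complex_norm hK).2.
Let ipFP := dot_inner_product ipF.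

(** [vbasis W] need not be orthonormal; dividing by [gamma] is the correction. *)
Lemma gram_orthov_neq0 : gamma != 0.
Proof. exact/(det_gram_free ipFP)/(basis_free (vbasisP W)). Qed.

Lemma gram_orthov_conj : conj gamma = gamma.
Proof. exact: det_gram_conj. Qed.

Section Compression.
Variables (x : 'I_s -> K) (ipE : {dot 'Hom(E, K^o) for conj}).
Hypotheses (hx : forall i, 0 < x i) (hip : orthogonal_dual_basis e x ipE).

Let ipEP := dot_inner_product ipE.
Local Notation dstar := (adjoint ipF ipE d).

Let conj_x i : conj (x i) = x i.
Proof. by rewrite (conj_ge0 conjN) // ltW. Qed.

Lemma transpose_adjoint u v : ipF u (dstar v) = ipE (d u) v.
Proof. exact: (adjointP ipFP ipEP). Qed.

Lemma adjoint_in_orthov v : dstar v \in W.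
Proof.
case: ipFP => _ ipC _; apply/mem_orthovP => u; rewrite memv_ker => /eqP u0.
by rewrite /= ipC transpose_adjoint u0 linear0l rmorph0.
Qed.

Lemma det_gram_evmx m (u : 'I_m -> 'Hom(E, K^o)) :
  \det (gram ipE u u) = \sum_(I : ksubset m s)
    `|\det (colsub (ksubset_nth I) (evmx e u))| ^+ 2 * \prod_(i in val I) x i.
Proof.
rewrite -(det_weighted_gram conjN); congr (\det _); apply/matrixP=> i j.
rewrite !mxE (dual_ipE he hip); apply: eq_bigr => l _.
by rewrite !mxE.
Qed.

(** The vectors h_i = d^* e_i^star lie in W, so h = c g for a square matrix [c]. Pairing with g
    gives det D_T times x^T, by adjunction; conjugating this pairing yields det c times [gamma],
    which determines det c. *)
Lemma det_gram_adjoint (T : ksubset n s) :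
  \det (gram ipF (dstar \o dual_vec e \o ksubset_nth T)
                 (dstar \o dual_vec e \o ksubset_nth T)) =
  `|\det (colsub (ksubset_nth T) D)| ^+ 2 / gamma * (\prod_(i in val T) x i) ^+ 2.
Proof.
set h := _ \o ksubset_nth T; set DT := \det (colsub _ _); set xT := \prod_(i in val T) x i.
have xTc : conj xT = xT.
  by rewrite rmorph_prod; apply: eq_bigr.
have [c hE] : exists c : 'M[K]_n, h = fun i => \sum_a c i a *: g a.
  have /choice[c cE] : forall i, exists c : 'I_n -> K, h i = \sum_a c a *: g a.
    by move=> i; apply: orthov_expand; exact: adjoint_in_orthov.
  exists (\matrix_(i, a) c i a); apply: funext => i; rewrite cE.
  by apply: eq_bigr => a _; rewrite mxE.
have gh : \det (gram ipF g h) = DT * xT.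
  have -> : gram ipF g h =
      colsub (ksubset_nth T) D *m diag_mx (\row_j x (ksubset_nth T j)).
    apply/matrixP=> a j; rewrite mul_mx_diag !mxE /= transpose_adjoint.
    exact: dual_ip_vec.
  rewrite det_mulmx det_diag; congr (_ * _); rewrite /xT -prod_ksubset.
  by apply: eq_bigr => j _; rewrite mxE.
have hh : \det (gram ipF h h) = \det c * (DT * xT).
  by rewrite -gh -det_mulmx -(gram_suml ipFP) -hE.
have hg : conj (DT * xT) = \det c * gamma.
  by rewrite -gh (det_gram_conj ipFP) -det_mulmx -(gram_suml ipFP) -hE.
rewrite hh -[\det c](mulfK gram_orthov_neq0) -hg rmorphM xTc -conjN.
by move: (gamma^-1) => gi; ring.
Qed.

(** Apply [lfun_det_gram] in E_T^* to the dual vectors over T. Their Gram matrix is diagonal with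
    determinant x^T, and by adjunction the compressed operator has the Gram matrix of the d^*
    e_i^star. One of the two factors x^T cancels. *)
Lemma det_compression (T : ksubset n s) :
  lfun_det (compression ipE (dual_span e (val T)) (d \o dstar)%VF) =
  `|\det (colsub (ksubset_nth T) D)| ^+ 2 / gamma * \prod_(i in val T) x i.
Proof.
set V := dual_span e (val T); set f := compression _ _ _.
pose ip (u v : subvs_of V) := ipE (vsval u) (vsval v).
have ipP : is_inner_product conj ip.
  case: ipEP => ipL ipC ip_gt0; split=> [a u w z|u w|u u0].
  - by rewrite /ip linearP ipL.
  - exact: ipC.
  apply: ip_gt0; apply: contra u0 => /eqP u0; apply/eqP.
  by apply: (can_inj (@vsvalK _ _ V)); rewrite u0 linear0.
pose v := dual_vec e \o ksubset_nth T.
have vV i : v i \in V.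
  apply/memv_span/mapP; exists (ksubset_nth T i) => //.
  by rewrite mem_enum -(ksubset_nthE T); apply: imset_f; rewrite inE.
pose u := vsproj V \o v.
have nE : n = \dim (fullv : {vspace subvs_of V}) by rewrite dimvf /dim /= dual_span_dim.
have := lfun_det_gram ipP f u u nE.
have -> : \det (gram ip u u) = \prod_(i in val T) x i.
  have -> : gram ip u u = diag_mx (\row_j x (ksubset_nth T j)).
    apply/matrixP=> i j; rewrite !mxE /ip !vsprojK //= (dual_ip_vec he hip) dual_vecE //.
    rewrite (inj_eq (@ksubset_nth_inj _ _ T)); case: eqP => [->|_].
      by rewrite mul1r mulr1n.
    by rewrite mul0r mulr0n.
  rewrite det_diag -prod_ksubset; by apply: eq_bigr => j _; rewrite mxE.
have -> : gram ip (f \o u) u = gram ipF (dstar \o dual_vec e \o ksubset_nth T)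
                 (dstar \o dual_vec e \o ksubset_nth T).
  apply/matrixP=> i j; rewrite !mxE /ip /= !vsprojK // /f /compression lfunE /= vsprojK; last first.
    exact: memv_pi.
  rewrite transpose_adjoint vsprojK // comp_lfunE.
  (* Projecting [y] on V subtracts a vector orthogonal to V, so the pairing with [v j] is
     unchanged. *)
  set y := d _; have [_ /mem_orthovP yo] := orthprojP ipE V y.
  have := yo _ (vV j); rewrite linearBl /= => /eqP; rewrite subr_eq0 => /eqP.
  by [].
rewrite det_gram_adjoint expr2 mulrA => fE.
have xT : \prod_(i in val T) x i != 0 by rewrite lt0r_neq0 ?prodr_gt0.
by apply: (mulIf xT); rewrite -fE.
Qed.

End Compression.

(** * The two polynomials and the Laplacian as quotients of Gram determinants *)

Section Polynomials.
Variables (x : 'I_s -> K) (ipE : {dot 'Hom(E, K^o) for conj}).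
Hypotheses (hx : forall i, 0 < x i) (hip : orthogonal_dual_basis e x ipE).

Let ipEP := dot_inner_product ipE.
Local Notation dstar := (adjoint ipF ipE d).

(** Existence is [det_compression]. For uniqueness, the defining identity is evaluated at the given
    [x] and [ipE], where x^T is nonzero. *)
Lemma basis_weightE (T : ksubset n s) :
  basis_weight e bd ipF (val T) = `|\det (colsub (ksubset_nth T) D)| ^+ 2 / gamma.
Proof.
set w := _ / _; have wP : is_basis_weight e bd ipF (val T) w.
  split=> [|y ip hy hy_ip]; last exact: det_compression.
  apply: rpredM; first by rewrite rpredX ?normr_real.
  by rewrite realV; apply: (conj_id_real conjN); exact: gram_orthov_conj.
apply: xget_unique => // w' w'P.
have xT0 : \prod_(i in val T) x i != 0 by rewrite lt0r_neq0 ?prodr_gt0.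
apply: (mulIf xT0).
by rewrite -(wP.2 x ipE hx hip) -(w'P.2 x ipE hx hip).
Qed.

Lemma basis_poly_gram :
  basis_poly e bd ipF x = \det (gram ipE (d \o g) (d \o g)) / gamma.
Proof.
rewrite (det_gram_evmx hip) mulr_suml /basis_poly.
(* All sets of size n are summed over; those that are not bases have a vanishing minor of D. *)
transitivity (\sum_(T : {set 'I_s} | #|T| == n)
    if T \in bases e bd then basis_weight e bd ipF T * \prod_(i in T) x i else 0).
  rewrite -big_mkcondr; apply: eq_bigl => T.
  case: (boolP (T \in bases e bd)) => [bT|]; last by rewrite andbF.
  by rewrite (card_bases he bT) (dim_orthov_ker _ ipF) eqxx.
rewrite sum_ksubset; apply: eq_bigr => T _; case: ifPn => [_|NT].
  by rewrite basis_weightE mulrAC.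
have -> : \det (colsub (ksubset_nth T) D) = 0.
  apply: contraNeq NT => /bases_imset.
  have -> : [set ksubset_nth T a | a : 'I_n] = val T.
    by rewrite -(ksubset_nthE T); apply/finset.setP=> i; apply/imsetP/imsetP=> -[a _ ->]; exists a.
  by [].
by rewrite normr0 expr0n !mul0r.
Qed.

Section Theta.
Variables (k : nat) (theta : k.-tuple 'Hom(E, K^o)).
Local Notation dtheta := (fcat (d \o g) (tnth theta)).

(** The right side does not mention T, so it meets the condition for every basis inside I at once;
    the existence of one such basis makes the value unique. *)
Lemma weightE (I : ksubset (n + k) s) : val I \in nbases e bd k ->
  weight e bd ipF theta (val I) =
  `|\det (colsub (ksubset_nth I) (evmx e dtheta))| ^+ 2 / gamma.
Proof.
rewrite inE => /andP[_ /exists_inP[T bT sTI]].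
have is_w : is_weight e bd ipF theta (val I)
    (`|\det (colsub (ksubset_nth I) (evmx e dtheta))| ^+ 2 / gamma).
  move=> T' bT' sTI'.
  have cT : #|T'| == n by rewrite (card_bases he bT') (dim_orthov_ker _ ipF).
  have T'E : T' = val (Sub T' cT : ksubset n s) by [].
  rewrite T'E in bT' sTI' *; rewrite basis_weightE evmx_fcat.
  by rewrite (norm_det_sub_bases he _ bT' sTI') exprMn mulrAC.
apply: xget_unique => // w w'P.
by rewrite (w'P T) // -(is_w T).
Qed.

Lemma nbases_poly_gram :
  nbases_poly e bd ipF theta x = \det (gram ipE dtheta dtheta) / gamma.
Proof.
rewrite (det_gram_evmx hip) mulr_suml /nbases_poly.
transitivity (\sum_(J : {set 'I_s} | #|J| == (n + k)%N)
    if J \in nbases e bd k then weight e bd ipF theta J * \prod_(i in J) x i else 0).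
  rewrite -big_mkcondr; apply: eq_bigl => J.
  by rewrite inE -(dim_orthov_ker _ ipF) andbA andbb.
rewrite sum_ksubset; apply: eq_bigr => J _; case: ifPn => [bJ|NJ].
  by rewrite weightE // mulrAC.
have -> : \det (colsub (ksubset_nth J) (evmx e dtheta)) = 0.
  apply: contraNeq NJ; rewrite evmx_fcat => /det_neq0_sub_bases[T bT sTJ].
  rewrite inE -(dim_orthov_ker _ ipF) (valP J) /=.
  by apply/exists_inP; exists T.
by rewrite normr0 expr0n !mul0r.
Qed.

(** The orthogonal of ker d^* is im d: with r the projection of q on im d, q - r lies in ker d^* and
    is orthogonal to both q and r, hence zero. *)
Lemma orthov_ker_adjoint q : q \in orthov ipE (lker dstar) ->
  exists c : 'I_n -> K, q = \sum_a c a *: d (g a).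
Proof.
move=> qo; pose r := orthproj ipE (limg d) q.
have [rL qrL] := orthprojP ipE (limg d) q.
have qrK : q - r \in lker dstar.
  rewrite memv_ker; apply/eqP/(ip_inj ipFP) => f.
  rewrite transpose_adjoint; case: ipEP => _ ipC _.
  rewrite ipC (mem_orthovP qrL _ (memv_img _ (memvf _))) rmorph0.
  by rewrite linear0r.
have qrE : q = r.
  apply/eqP; rewrite -subr_eq0; apply/eqP/(ip0_eq0 ipEP).
  rewrite [X in X = _]linearBl /= (mem_orthovP qo _ qrK).
  by case: ipEP => _ ipC _; rewrite [X in _ - X]ipC (mem_orthovP qrL _ rL) rmorph0 subr0.
have /memv_imgP[f _ rE] := rL; have [h hW dE] := transpose_orthov bd ipF f.
have [c hE] := orthov_expand hW; exists c.
by rewrite qrE /r rE dE hE linear_sum; apply: eq_bigr => a _; rewrite linearZ.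
Qed.

(** Row operations replace theta_i by p_i. As p_i is orthogonal to im d, and theta_j - p_j to ker
    d^*, the lower blocks become 0 and the Gram matrix of p. *)
Lemma det_gram_fcat :
  let p i := orthproj ipE (lker dstar) (tnth theta i) in
  \det (gram ipE dtheta dtheta) =
  \det (gram ipE (d \o g) (d \o g)) * \det (gram ipE p p).
Proof.
move=> p; case: ipEP => _ ipC _.
have pP i : p i \in lker dstar /\ tnth theta i - p i \in orthov ipE (lker dstar).
  exact: orthprojP.
have /choice[c cE] : forall i, exists c : 'I_n -> K,
    tnth theta i - p i = \sum_a c a *: d (g a).
  by move=> i; apply: orthov_ker_adjoint; case: (pP i).
pose C : 'M[K]_(k, n) := \matrix_(i, a) c i a.
have thetaE m (w : 'I_m -> 'Hom(E, K^o)) :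
    gram ipE (tnth theta) w = C *m gram ipE (d \o g) w + gram ipE p w.
  rewrite -(gram_suml ipEP); apply/matrixP=> i j.
  rewrite !mxE -{1}(subrK (p i) (tnth theta i)) linearDl /= cE.
  congr (ipE _ _ + _); by apply: eq_bigr => a _; rewrite mxE.
have pd : gram ipE p (d \o g) = 0.
  apply/matrixP=> i a; rewrite !mxE ipC -(transpose_adjoint ipE).
  case: (pP i); rewrite memv_ker => /eqP-> _.
  by rewrite linear0r rmorph0.
have pt : gram ipE p (tnth theta) = gram ipE p p.
  apply/matrixP=> i j; rewrite !mxE; apply/eqP; rewrite -subr_eq0 -linearBr /= ipC.
  case: (pP i) (pP j) => pK _ [_ rO].
  by rewrite (mem_orthovP rO _ pK) rmorph0.
have -> : gram ipE dtheta dtheta = block_mx 1%:M 0 C 1%:M *m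
    block_mx (gram ipE (d \o g) (d \o g)) (gram ipE (d \o g) (tnth theta)) 0 (gram ipE p p).
  rewrite mulmx_block !mul1mx !mul0mx !addr0 gram_fcat.
  by rewrite !thetaE pd pt addr0.
by rewrite det_mulmx det_lblock det_ublock !det1 !mul1r.
Qed.

(** [lfun_det_gram] is applied to the basis [u] made of g and the standard basis of K^k. Its image
    under [dsum_map] is [dtheta], and its own Gram determinant is [gamma]. *)
Lemma det_laplacian :
  lfun_det (laplacian bd ipF theta ipE) = \det (gram ipE dtheta dtheta) / gamma.
Proof.
pose U := (subvs_of W * 'rV[K]_k)%type.
pose ipU := @dsum_ip _ _ _ ipF W k.
have ipUP : is_inner_product conj ipU := dsum_inner_product hK ipF W k.
pose u : 'I_(n + k) -> U :=
  fcat (fun a => (vsproj W (g a), 0)) (fun b => (0, delta_mx 0 b)).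
have uE i : dsum_map bd ipF theta (u i) = dtheta i.
  rewrite dsum_mapE /u /fcat; case: split => a /=.
    rewrite vsprojK ?basis_in_orthov // big1 ?addr0 // => b _.
    by rewrite mxE scale0r.
  rewrite !linear0 add0r (bigD1 a) //= big1 ?addr0 => [|b ba]; rewrite mxE eqxx.
    by rewrite eqxx scale1r.
  by rewrite (negPf ba) scale0r.
have nkE : (n + k)%N = \dim (fullv : {vspace U}).
  by rewrite dimvf /dim /= /dim /= mul1n.
have := lfun_det_gram ipUP (laplacian bd ipF theta ipE) u u nkE.
have -> : gram ipU (laplacian bd ipF theta ipE \o u) u = gram ipE dtheta dtheta.
  apply/matrixP=> i j; rewrite !mxE /= comp_lfunE -!uE.
  have [_ ipUC _] := ipUP; have [_ ipEC _] := ipEP.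
  by rewrite ipUC [ipU _ _](adjointP ipUP ipEP) /inner -ipEC.
have -> : gram ipU u u = block_mx (gram ipF g g) 0 0 1%:M.
  rewrite gram_fcat; congr block_mx; apply/matrixP=> i j; rewrite !mxE /ipU /dsum_ip /=.
  - rewrite !vsprojK ?basis_in_orthov // big1 ?addr0 // => b _.
    by rewrite !mxE mul0r.
  - rewrite linear0r add0r big1 // => b _.
    by rewrite !mxE mul0r.
  - rewrite linear0l add0r big1 // => b _.
    by rewrite !mxE rmorph0 mulr0.
  rewrite linear0l add0r (bigD1 i) //= big1 ?addr0 => [|b bi].
    by rewrite !mxE !eqxx mul1r rmorph_nat.
  by rewrite !mxE (negPf bi) mul0r.
rewrite det_ublock det1 mulr1 => ->.
by rewrite mulfK ?gram_orthov_neq0.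
Qed.

End Theta.
End Polynomials.
End Weights.

Theorem proposition13p14 (R : realType) (K : numFieldType)
    (conj : {rmorphism K -> K}) (hK : real_or_complex R conj)
    (s : nat) (E F : vectType K)
    (e : s.-tuple E) (he : basis_of {:E} e) (bd : 'Hom(E, F))
    (ipF : {dot 'Hom(F, K^o) for conj}) (ipE : {dot 'Hom(E, K^o) for conj})
    (x : 'I_s -> K) (hx : forall i, 0 < x i)
    (hip : orthogonal_dual_basis e x ipE)
    (k : nat) (theta : k.-tuple 'Hom(E, K^o)) (hfree : free theta)
    (hcap : (limg (transpose bd) :&: <<theta>>)%VS = 0%VS) :
  let vartheta := wedge (tnth theta) in
  let projected :=
    ext_map (orthproj ipE (lker (adjoint ipF ipE (transpose bd)))) vartheta in
  nbases_poly e bd ipF theta x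
    = basis_poly e bd ipF x * ext_ip ipE projected projected /\
  basis_poly e bd ipF x * ext_ip ipE projected projected
    = lfun_det (laplacian bd ipF theta ipE).
Proof.
(* The squared norm becomes the Gram determinant of the projected theta_i. *)
rewrite /= ext_map_wedge ext_ip_wedge.
rewrite (basis_poly_gram hK he _ _ hx hip) (nbases_poly_gram hK he _ _ hx hip).
by rewrite (det_laplacian hK) det_gram_fcat mulrAC.
Qed.
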